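(* Let $k>i\ge 1$, $n\ge i-1$ and $r,s\ge 1$ be integers. Then the number of colour decompositions with remainder at most $i-1$ of the set $X=\{1,2,\ldots,n+1\}$ is equal to $F^{i}_{r,s}(k,n)$.
   Context: For integers $i,k,r,s\ge 1$, the sequence $F^{i}_{r,s}(k,n)$, $n\ge -1$, is defined as follows. If $i\le k$, then $F^{i}_{r,s}(k,n)=r^{\lfloor (n+1)/i\rfloor}$ for $n=-1,0,\ldots,k-2$; if $k<i$, then $F^{i}_{r,s}(k,n)=s^{\lfloor (n+1)/k\rfloor}$ for $n=-1,0,\ldots,i-2$; and for all $n\ge \max\{k,i\}-1$, $F^{i}_{r,s}(k,n)=rF^{i}_{r,s}(k,n-i)+sF^{i}_{r,s}(k,n-k)$. A colour decomposition with remainder at most $i-1$ of $X=\{1,\ldots,n+1\}$ is a family $\{Y_t : t\in T\}$ of pairwise disjoint subsets of $X$, each $Y_t$ consisting of consecutive integers, together with an assignment of one colour to each $Y_t$, such that: (1) $|Y_t|\in\{i,k\}$ for all $t\in T$; (2) if $|Y_t|=i$, the colour of $Y_t$ is one of $r$ available colours; (3) if $|Y_t|=k$, the colour of $Y_t$ is one of $s$ available colours; (4) $|X\setminus\bigcup_{t\in T}Y_t|\le i-1$; (5) every $x\in X\setminus\bigcup_{t\in T}Y_t$ satisfies $x\in\{n+3-i,\ldots,n,n+1\}$ (this set of the last $i-1$ elements is empty when $i=1$). Two colour decompositions are the same if they have the same sets with the same colours. *)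

(* Defs.v *)
From mathcomp Require Import all_boot all_order all_algebra zify.

Set Implicit Arguments.
Unset Strict Implicit.
Unset Printing Implicit Defensive.

(* [Fsh i k r s m] is F^i_{r,s}(k, m - 1): the sequence starts at index -1, so
   it is computed on the shifted index m = n + 1.  The first argument of [Fsh_rec] is fuel;
   since i, k >= 1, fuel larger than m is always enough. *)
Fixpoint Fsh_rec (fuel i k r s m : nat) : nat :=
  if fuel is f.+1 then
    if m < maxn k i then
      if i <= k then r ^ (m %/ i) else s ^ (m %/ k)
    else r * Fsh_rec f i k r s (m - i) + s * Fsh_rec f i k r s (m - k)
  else 0.

Definition Fsh (i k r s m : nat) : nat := Fsh_rec m.+1 i k r s m.

(* [F i r s k n] is F^i_{r,s}(k, n) for n >= -1; the value for n < -1 is irrelevant. *)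
Definition F (i r s k : nat) (n : int) : nat := Fsh i k r s `|(n + 1)%R|.

Lemma Fsh_rec_fuel i k r s f g m : 0 < i -> 0 < k -> m < f -> m < g ->
  Fsh_rec f i k r s m = Fsh_rec g i k r s m.
Proof.
move=> i0 k0; elim: f g m => [|f IH] [|g] m //= mf mg.
case: ltnP => // hm; have := leq_maxl k i; have := leq_maxr k i => h1 h2.
by congr (_ * _ + _ * _); apply: IH; lia.
Qed.

Lemma F_init_le i r s k m : i <= k -> m < k ->
  F i r s k (m%:Z - 1)%R = r ^ (m %/ i).
Proof.
move=> ik mk; have -> : F i r s k (m%:Z - 1)%R = Fsh i k r s m.
  by rewrite /F; congr Fsh; lia.
by rewrite /Fsh /= ik leq_max mk.
Qed.

Lemma F_init_gt i r s k m : k < i -> m < i ->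
  F i r s k (m%:Z - 1)%R = s ^ (m %/ k).
Proof.
move=> ki mi; have -> : F i r s k (m%:Z - 1)%R = Fsh i k r s m.
  by rewrite /F; congr Fsh; lia.
by rewrite /Fsh /= (leqNgt i k) ki leq_max mi orbT.
Qed.

Lemma F_rec i r s k (n : int) : 0 < i -> 0 < k ->
  ((maxn k i)%:Z - 1 <= n)%R ->
  F i r s k n = r * F i r s k (n - i%:Z)%R + s * F i r s k (n - k%:Z)%R.
Proof.
move=> i0 k0 hn; rewrite /F.
have h1 := leq_maxl k i; have h2 := leq_maxr k i.
set m := `|(n + 1)%R|.
have -> : `|(n - i%:Z + 1)%R| = m - i by rewrite /m; lia.
have -> : `|(n - k%:Z + 1)%R| = m - k by rewrite /m; lia.
have hm : maxn k i <= m by rewrite /m; lia.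
rewrite {1}/Fsh /= ltnNge hm /=.
by congr (_ * _ + _ * _); apply: Fsh_rec_fuel; lia.
Qed.

(* The set X = {1, ..., n + 1}, inside {0, ..., n + 1}. *)
Definition X (n : nat) : {set 'I_n.+2} := [set x : 'I_n.+2 | 1 <= x <= n + 1].

Definition consecutive (n : nat) (Y : {set 'I_n.+2}) : bool :=
  [exists a : 'I_n.+2, Y == [set x : 'I_n.+2 | a <= x < a + #|Y|]].

(* The r colours for blocks of size i are [inl c], the s colours for blocks of
   size k are [inr c]. *)
Notation colour r s := ('I_r + 'I_s)%type.

Definition is_inl (A B : Type) (c : A + B) : bool :=
  if c is inl _ then true else false.

Definition remainder (n r s : nat) (D : {set {set 'I_n.+2} * colour r s})
  : {set 'I_n.+2} := X n :\: \bigcup_(p in D) p.1.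

(* A family of disjoint coloured blocks is the set of its pairs
   (block, colour): blocks are nonempty when i, k >= 1, so distinct indices
   give distinct pairs, and two decompositions with the same sets and the same
   colours are equal. *)
Definition colour_decomposition (n i k r s : nat)
    (D : {set {set 'I_n.+2} * colour r s}) : bool :=
  [&& [forall p in D, (p.1 \subset X n) && consecutive p.1],
      [forall p in D, forall q in D, (p != q) ==> [disjoint p.1 & q.1]],
      [forall p in D, (#|p.1| == i) || (#|p.1| == k)],
      [forall p in D, (#|p.1| == i) ==> is_inl p.2],
      [forall p in D, (#|p.1| == k) ==> ~~ is_inl p.2],
      #|remainder D| <= i - 1
    & [forall x in remainder D, n + 3 - i <= x <= n + 1]].

(* Main.v *)
(** An uncovered point [x] lies among the last [i - 1] ones, so no block, having
    at least [i] points, fits to its right: the blocks tile an initial segment.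
    Keep the right end [n + 1] fixed and let the left end [a] vary.  If at least
    [i] points remain, [a] is covered, by a block starting at [a] whose
    length is dictated by its colour; removing it leaves a decomposition of
    [{a + i, ..., n + 1}] or [{a + k, ..., n + 1}], which is the recurrence of
    [F].  With [m < k] points left only the blocks of size [i] fit, which gives
    the initial values [r ^ (m %/ i)]. *)
Require Import Defs.
From mathcomp Require Import all_boot all_order all_algebra.
From mathcomp Require Import zify.

Set Implicit Arguments.
Unset Strict Implicit.
Unset Printing Implicit Defensive.

Section Tilings.

Variables (n i k r s : nat).
Hypotheses (i_gt0 : 0 < i) (ltik : i < k).

Local Notation point := 'I_n.+2.
Local Notation block := ({set point} * colour r s)%type.

Definition itv (a b : nat) : {set point} := [set x : point | a <= x < b].

Lemma mem_itv a b (x : point) : (x \in itv a b) = (a <= x < b).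
Proof. by rewrite inE. Qed.

Lemma card_itv a b : b <= n.+2 -> #|itv a b| = b - a.
Proof.
(* Both sides become sums of ones; as [b <= n.+2], the ordinal type cuts nothing off. *)
move=> le_b; rewrite -[RHS]muln1 -sum_nat_const_nat (big_nat_widenl _ 0) //.
rewrite (big_nat_widen _ _ n.+2) // big_mkord -sum1_card.
by apply: eq_bigl => x; rewrite mem_itv.
Qed.

(** Since [i < k], the summand of a colour fixes the size of its block, so a left end and a colour
    determine a block. *)
Definition len (c : colour r s) : nat := if is_inl c then i else k.

Lemma len_ge c : i <= len c.
Proof. by rewrite /len; case: ifP => // _; apply: ltnW. Qed.

Definition block_at (a : nat) (c : colour r s) : block := (itv a (a + len c), c).

(* The bound on the size of the remainder is omitted: it follows from the
   position of its elements. *)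
Definition tiling (a : nat) (D : {set block}) : bool :=
  [&& [forall p in D, [exists b : point, [exists c : colour r s,
         [&& a <= b, b + len c <= n.+2 & p == block_at b c]]]],
      [forall p in D, forall q in D, (p != q) ==> [disjoint p.1 & q.1]]
    & [forall x : point, (a <= x) && (x + i <= n.+2) ==>
         [exists p in D, x \in p.1]]].

Definition blocks_from a (D : {set block}) := forall p, p \in D ->
  exists (b : point) (c : colour r s),
    [/\ a <= b, b + len c <= n.+2 & p = block_at b c].

Definition disjoint_blocks (D : {set block}) := forall p q (x : point),
  p \in D -> q \in D -> x \in p.1 -> x \in q.1 -> p = q.

Definition covers_from a (D : {set block}) := forall x : point,
  a <= x -> x + i <= n.+2 -> exists2 p, p \in D & x \in p.1.

Lemma disjoint_blocksP (D : {set block}) :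
  reflect (disjoint_blocks D)
    [forall p in D, forall q in D, (p != q) ==> [disjoint p.1 & q.1]].
Proof.
apply: (iffP forall_inP) => [dD p q x pD qD xp xq | dD p pD].
  apply/eqP; apply: contraT => pq.
  move/(_ p pD)/forall_inP/(_ q qD): dD; rewrite pq /= => /disjointFr/(_ xp).
  by rewrite xq.
apply/forall_inP => q qD; apply/implyP => pq; rewrite -setI_eq0.
apply: contraNT pq => /set0Pn[x]; rewrite inE => /andP[xp xq].
by apply/eqP/(dD p q x).
Qed.

Lemma tilingP a D :
  reflect [/\ blocks_from a D, disjoint_blocks D & covers_from a D] (tiling a D).
Proof.
apply: (iffP and3P) => [] [h1 h2 h3]; split; try by apply/disjoint_blocksP.
- move=> p pD; move/forall_inP/(_ p pD)/existsP: h1 => [b /existsP[c]].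
  by case/and3P=> ? ? /eqP ?; exists b, c.
- move=> x ax xi; move/forallP/(_ x): h3; rewrite ax xi /=.
  by move=> /exists_inP.
- apply/forall_inP => p pD; have [b [c [h h' e]]] := h1 p pD.
  by apply/existsP; exists b; apply/existsP; exists c; rewrite h h' e /=.
- apply/forallP => x; apply/implyP => /andP[ax xi].
  by apply/exists_inP/h3.
Qed.

Lemma mem_block_at a c (x : point) :
  (x \in (block_at a c).1) = (a <= x < a + len c).
Proof. exact: mem_itv. Qed.

Lemma tiling_block_ge a D p (x : point) :
  tiling a D -> p \in D -> x \in p.1 -> a <= x.
Proof.
case/tilingP => hb _ _ /hb[b [c [ab _ ->]]]; rewrite mem_block_at; lia.
Qed.

(** The blocks of [D] start no earlier than [a + len c], and the new block covers exactly the points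
    from [a] up to there. *)
Lemma tilingU1 a c D : a + len c <= n.+2 -> tiling (a + len c) D ->
  tiling a (block_at a c |: D).
Proof.
move=> ac tD; have lc := len_ge c.
have /tilingP[bD dD cD] := tD.
have a_lt : a < n.+2 by lia.
apply/tilingP; split.
- move=> p /setU1P[-> | /bD[b [d [ab bn ->]]]].
    by exists (Ordinal a_lt), c.
  by exists b, d; split=> //; lia.
- move=> p q x /setU1P[-> | pD] /setU1P[-> | qD] //; last exact: dD.
    rewrite mem_block_at => xa /(tiling_block_ge tD qD); lia.
  move=> /(tiling_block_ge tD pD) ? ; rewrite mem_block_at; lia.
- move=> x ax xn; have [xc | cx] := ltnP x (a + len c).
    by exists (block_at a c); rewrite ?setU11 // mem_block_at ax.
  by have [p pD xp] := cD x cx xn; exists p; rewrite // setU1r.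
Qed.

(** Another block starting before [a + len c] would meet the removed one in its own left end, and
    disjointness would make the two equal. *)
Lemma tilingD1 a c D : tiling a D -> block_at a c \in D ->
  tiling (a + len c) (D :\ block_at a c).
Proof.
have lc := len_ge c; case/tilingP => bD dD cD cinD; apply/tilingP; split.
- move=> p /setD1P[pc pD]; have [b [d [ab bn e]]] := bD p pD.
  exists b, d; split=> //; rewrite leqNgt; apply: contra pc => ba; apply/eqP.
  have ld := len_ge d.
  apply: (dD p (block_at a c) b) => //; rewrite ?e mem_block_at; lia.
- by move=> p q x /setD1P[_ pD] /setD1P[_ qD]; apply: dD.
- move=> x ax xn; have [|p pD xp] := cD x _ xn; first by lia.
  exists p => //; rewrite !inE pD andbT; apply: contraTneq xp => ->.
  by rewrite mem_block_at; lia.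
Qed.

(** Inserting and removing the block are mutually inverse, because no tiling from [a + len c]
    contains it. *)
Lemma card_tiling_block a c :
  #|[set D | tiling a D & block_at a c \in D]| =
    if a + len c <= n.+2 then #|[set D | tiling (a + len c) D]| else 0.
Proof.
have lc := len_ge c; case: leqP => [ac | ca]; last first.
  apply/eqP; rewrite cards_eq0; apply/eqP/setP => D; rewrite !inE.
  apply/negP => /andP[/tilingP[bD _ _] /bD[b [d [ab bn e]]]].
  (* Comparing colours suffices: as [a <= b], a block of colour [c] starting at [b] would overrun
     the range. *)
  have dc : d = c by case: e.
  by rewrite dc in bn; lia.
have a_lt : a < n.+2 by lia.
have notin D : tiling (a + len c) D -> block_at a c \notin D.
  move=> tD; apply/negP => cD.
  have : Ordinal a_lt \in (block_at a c).1 by rewrite mem_block_at /=; lia.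
  by move=> /(tiling_block_ge tD cD) /=; lia.
rewrite -[RHS](@card_in_imset _ _ (fun D => block_at a c |: D)); last first.
  move=> D E; rewrite !inE => /notin cD /notin cE.
  move/(congr1 (fun G => G :\ block_at a c)).
  by rewrite !setU1K.
apply: eq_card => D; rewrite !inE; apply/andP/imsetP => [[tD cD] | [E]].
  exists (D :\ block_at a c); last by rewrite setD1K.
  by rewrite inE; apply: tilingD1.
by rewrite inE => tE ->; split; [apply: tilingU1 | apply: setU11].
Qed.

(** The point [a] must be covered, and by a block starting there, since none starts earlier; two
    blocks at [a] would share this point. *)
Lemma sum_block_at a D : a + i <= n.+2 -> tiling a D ->
  \sum_(c : colour r s) (block_at a c \in D : nat) = 1.
Proof.
move=> an /tilingP[bD dD cD].
have a_lt : a < n.+2 by lia.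
have [p pD ap] := cD (Ordinal a_lt) (leqnn _) an.
have [b [d [ab bn e]]] := bD p pD; rewrite {p}e in pD ap.
have ba : b = a :> nat by move: ap; rewrite mem_block_at /=; lia.
rewrite ba in pD ap; rewrite (bigD1 d) //= pD big1 // => c cd.
apply/eqP; rewrite eqb0; apply: contra cd => cinD.
have lc := len_ge c.
suff [_ ->] : block_at a c = block_at a d by [].
by apply: (dD _ _ (Ordinal a_lt)); rewrite // mem_block_at /=; lia.
Qed.

(** Double counting of pairs of a tiling and the colour of its first block. The guard on [a + k]
    matters: past the range the number of tilings is 1, from the empty family, while the
    contribution must be 0. *)
Lemma card_tiling_rec a : a + i <= n.+2 ->
  #|[set D | tiling a D]| =
    r * #|[set D | tiling (a + i) D]|
    + s * (if a + k <= n.+2 then #|[set D | tiling (a + k) D]| else 0).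
Proof.
move=> an.
have -> : #|[set D | tiling a D]| =
    \sum_c #|[set D | tiling a D & block_at a c \in D]|.
  rewrite -sum1_card.
  under [RHS]eq_bigr => c _ do
    rewrite -sum1dep_card big_mkcondr.
  rewrite exchange_big /=; apply: eq_big => D; rewrite !inE // => tD.
  by rewrite -[LHS](sum_block_at an tD); apply: eq_bigr => c _; case: ifP.
under eq_bigr => c _ do rewrite card_tiling_block.
by rewrite big_sumType /= /len /= !sum_nat_const !card_ord an.
Qed.

(** No block fits and no point has to be covered, which leaves the empty family. *)
Lemma card_tiling_short a : n.+2 < a + i -> #|[set D | tiling a D]| = 1.
Proof.
move=> an; rewrite -(cards1 (set0 : {set block})); apply: eq_card => D.
rewrite !inE; apply/idP/eqP => [/tilingP[bD _ _] | ->].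
  apply/setP => p; rewrite inE; apply/negP => /bD[b [c [ab bn _]]].
  by have := len_ge c; lia.
apply/tilingP; split=> [p | p q x | x ax xn]; rewrite ?inE //; lia.
Qed.

Lemma card_tiling f a : a <= n.+2 -> n.+2 - a < f ->
  #|[set D | tiling a D]| = Fsh_rec f i k r s (n.+2 - a).
Proof.
elim: f a => // f IH a an af /=.
have -> : maxn k i = k by lia.
have -> : i <= k by lia.
have [short | long] := ltnP n.+2 (a + i).
  (* Fewer than [i] points remain, so the exponent is 0. *)
  by rewrite card_tiling_short // ifT ?divn_small //; lia.
rewrite card_tiling_rec // IH ?subnDA; try lia.
case: ltnP => [ltk | lek]; last first.
  by rewrite ifT ?IH ?subnDA //; lia.
(* Here [i <= n.+2 - a < k]: the value at [n.+2 - a - i] is again an initial one, and the factor [r]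
   raises its exponent by one. *)
rewrite ifF ?muln0 ?addn0; last by lia.
case: f IH af => [|f] IH af /=; first by lia.
rewrite !ifT; try lia.
rewrite -expnS; congr (_ ^ _).
rewrite -[in RHS](subnK (n := n.+2 - a) (m := i)); last by lia.
by rewrite divnDr // divnn i_gt0 addn1.
Qed.

Lemma colour_decompositionE (D : {set block}) : i <= n.+1 ->
  colour_decomposition i k D = tiling 1 D.
Proof.
move=> le_in; apply/idP/idP.
  case/and5P => h1 h2 h3 h4 /and3P[h5 _ h7].
  apply/tilingP; split; last 1 first.
  (* A point outside all blocks lies in the remainder, hence beyond [n + 2 - i]. *)
  - move=> x x1 xn; have [|] := boolP (x \in remainder D).
      by move=> xR; move/forall_inP/(_ x xR): h7 => ?; exfalso; lia.
    rewrite !inE negb_and negbK => /orP[/bigcupP[p pD xp]|]; first by exists p.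
    by have := ltn_ord x; lia.
  - move=> [Y c] pD.
    have /= e : #|Y| = len c.
      move/forall_inP/(_ _ pD): h4; move/forall_inP/(_ _ pD): h5.
      move/forall_inP/(_ _ pD)/orP: h3 => [] /eqP /= ->; rewrite eqxx.
        by rewrite /len => _ h; rewrite ifT.
      by rewrite /len => /negPf h; rewrite ifF.
    have lc := len_ge c.
    move/forall_inP/(_ _ pD)/andP: h1 => [/subsetP /= YX /existsP[b /eqP]].
    rewrite /= e -/(itv _ _) => Yb.
    have bY : b \in Y by rewrite Yb mem_itv; lia.
    exists b, c; split; last by rewrite /block_at -Yb.
      by have := YX b bY; rewrite inE; lia.
    (* The ordinal type would silently truncate a block that is too long, so its right end is
       bounded by counting: [Y] has [len c] points, all between [b] and [n + 1]. *)
    rewrite leqNgt; apply/negP => bn.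
    have : #|Y| <= #|itv b n.+2|.
      apply/subset_leq_card/subsetP => x; rewrite Yb !mem_itv.
      by have := ltn_ord x; lia.
    by rewrite card_itv // e; have := ltn_ord b; lia.
  - exact/disjoint_blocksP.
case/tilingP => bD dD cD.
have cardp p : p \in D -> #|p.1| = len p.2.
  by case/bD => b [c [_ bn ->]]; rewrite card_itv //= addKn.
have rem x : x \in remainder D -> n + 3 - i <= x <= n + 1.
  rewrite !inE => /andP[xD xn]; have [xi|] := leqP (x + i) n.+2; last by lia.
  have [|p pD xp] := cD x _ xi; first by lia.
  by case/bigcupP: xD; exists p.
apply/and5P; split; [| exact/disjoint_blocksP | | | apply/and3P; split].
- apply/forall_inP => p pD; have pl := cardp p pD.
  have [b [c [b1 bn e]]] := bD p pD; apply/andP; split.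
    by apply/subsetP => x; rewrite e mem_block_at !inE; have := ltn_ord x; lia.
  by apply/existsP; exists b; rewrite pl e.
- by apply/forall_inP => p /cardp ->; rewrite /len; case: ifP; rewrite eqxx ?orbT.
- apply/forall_inP => p /cardp ->; apply/implyP; rewrite /len.
  by case: ifP => // _; rewrite gtn_eqF.
- apply/forall_inP => p /cardp ->; apply/implyP; rewrite /len.
  by case: ifP => [_ | /negbT //]; rewrite ltn_eqF.
- apply: (@leq_trans #|itv (n + 3 - i) n.+2|).
    by apply/subset_leq_card/subsetP => x /rem; rewrite mem_itv; lia.
  by rewrite card_itv //; lia.
- by apply/forall_inP.
Qed.

End Tilings.

Theorem theorem3p3 (i k n r s : nat) (hi : 1 <= i) (hik : i < k)
    (hn : i - 1 <= n) (hr : 1 <= r) (hs : 1 <= s) :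
  #|[set D : {set {set 'I_n.+2} * colour r s} |
       colour_decomposition i k D]| = F i r s k n%:Z.
Proof.
have -> : F i r s k n%:Z = Fsh i k r s n.+1 by rewrite /F; congr Fsh; lia.
(* [X n] starts at 1, so the tilings are taken from [a = 1], with [n + 1] points remaining. *)
rewrite /Fsh -[n.+1 in RHS]/(n.+2 - 1) -card_tiling; try lia.
apply: eq_card => D; rewrite !inE; apply: colour_decompositionE; lia.
Qed.
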